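(* Let $a<b$ and $c<d$ be real numbers, let $\Delta=[a,b]\times[c,d]$, let $g:\Delta\to\mathbb{R}$ be convex on the co-ordinates on $\Delta$, and let $f:\Delta\to\mathbb{R}$ be $g$-convex dominated on the co-ordinates. For $\varphi\in\{f,g\}$ define $H_\varphi:[0,1]^2\to\mathbb{R}$ by $$H_\varphi(t,s)=\frac{1}{(b-a)(d-c)}\int_a^b\int_c^d \varphi\left(tx+(1-t)\frac{a+b}{2},\,sy+(1-s)\frac{c+d}{2}\right)dy\,dx.$$ Then: (i) $H_g$ is convex on the co-ordinates on $[0,1]^2$ and $H_f$ is $H_g$-convex dominated on the co-ordinates on $[0,1]^2$. (ii) For all $0\le t_1<t_2\le 1$ and $0\le s_1<s_2\le 1$, $$0\le |H_f(t_2,s_2)-H_f(t_1,s_1)|\le H_g(t_2,s_2)-H_g(t_1,s_1).$$ (iii) For all $t,s\in[0,1]$, $$\left|f\left(\frac{a+b}{2},\frac{c+d}{2}\right)-H_f(t,s)\right|\le H_g(t,s)-g\left(\frac{a+b}{2},\frac{c+d}{2}\right)$$ and $$\left|\frac{1}{(b-a)(d-c)}\int_a^b\int_c^d f(x,y)\,dy\,dx-H_f(t,s)\right|\le \frac{1}{(b-a)(d-c)}\int_a^b\int_c^d g(x,y)\,dy\,dx-H_g(t,s).$$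
   Context: One variable: if $I\subseteq\mathbb{R}$ is an interval and $k:I\to\mathbb{R}$ is convex, a function $h:I\to\mathbb{R}$ is called $k$-convex dominated on $I$ if $$|\lambda h(u)+(1-\lambda)h(w)-h(\lambda u+(1-\lambda)w)|\le \lambda k(u)+(1-\lambda)k(w)-k(\lambda u+(1-\lambda)w)$$ for all $u,w\in I$, $\lambda\in[0,1]$. For a function $\varphi$ on a rectangle $[a,b]\times[c,d]$ (in particular on $[0,1]^2$), its partial mappings are $\varphi_x:[c,d]\to\mathbb{R}$, $\varphi_x(u)=\varphi(x,u)$ (for $x\in[a,b]$) and $\varphi_y:[a,b]\to\mathbb{R}$, $\varphi_y(w)=\varphi(w,y)$ (for $y\in[c,d]$). The function $\varphi$ is convex on the co-ordinates if all the partial mappings $\varphi_x$ and $\varphi_y$ are convex. Given $g$ convex on the co-ordinates on a rectangle $[a,b]\times[c,d]$, a real function $f$ on the same rectangle is $g$-convex dominated on the co-ordinates if $f_x$ is $g_x$-convex dominated on $[c,d]$ for every $x\in[a,b]$ and $f_y$ is $g_y$-convex dominated on $[a,b]$ for every $y\in[c,d]$. *)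

(* Defs.v *)
From Stdlib Require Import Reals.
From Coquelicot Require Import Coquelicot.
Open Scope R_scope.

Definition segment (a b : R) : R -> Prop := fun x => a <= x <= b.

(* In the next two definitions [I] is meant to be an interval. Functions on
   [I] are represented by total functions whose values off [I] play no role. *)
Definition convex_on (I : R -> Prop) (k : R -> R) : Prop :=
  forall u w lambda : R, I u -> I w -> 0 <= lambda <= 1 ->
    k (lambda * u + (1 - lambda) * w) <= lambda * k u + (1 - lambda) * k w.

(* The notion is used for [k] convex on [I]; this is not repeated here. *)
Definition convex_dominated_on (I : R -> Prop) (k h : R -> R) : Prop :=
  forall u w lambda : R, I u -> I w -> 0 <= lambda <= 1 ->
    Rabs (lambda * h u + (1 - lambda) * h w - h (lambda * u + (1 - lambda) * w))
    <= lambda * k u + (1 - lambda) * k w - k (lambda * u + (1 - lambda) * w).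

Definition coord_convex (a b c d : R) (phi : R -> R -> R) : Prop :=
  (forall x, segment a b x -> convex_on (segment c d) (fun u => phi x u)) /\
  (forall y, segment c d y -> convex_on (segment a b) (fun w => phi w y)).

(* The notion is used for [g] convex on the co-ordinates. *)
Definition coord_convex_dominated (a b c d : R) (g f : R -> R -> R) : Prop :=
  (forall x, segment a b x ->
     convex_dominated_on (segment c d) (fun u => g x u) (fun u => f x u)) /\
  (forall y, segment c d y ->
     convex_dominated_on (segment a b) (fun w => g w y) (fun w => f w y)).

(* Mean value over [a,b] x [c,d], as an iterated Riemann integral. For [phi]
   convex on the co-ordinates, or dominated on the co-ordinates by such a
   function, both integrals exist (the inner one for every x in [a,b]), so the
   default value of [RInt] for non-integrable functions is never used. *)
Definition mean_value (a b c d : R) (phi : R -> R -> R) : R :=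
  1 / ((b - a) * (d - c)) * RInt (fun x => RInt (fun y => phi x y) c d) a b.

(* For t, s in [0,1] the points at which [phi] is evaluated stay in
   [a,b] x [c,d]. *)
Definition Hmap (a b c d : R) (phi : R -> R -> R) (t s : R) : R :=
  mean_value a b c d
    (fun x y => phi (t * x + (1 - t) * ((a + b) / 2))
                    (s * y + (1 - s) * ((c + d) / 2))).

(* Main.v *)
(** [f] is [g]-convex dominated exactly when [g + f] and [g - f] are convex, so
    by linearity of [phi |-> H_phi] everything reduces to a single function
    [phi] convex on the co-ordinates. For such a [phi], [H_phi] is an iterate of
    the one-variable operator [k |-> (t |-> int k (t x + (1 - t) m) dx)], [m]
    being the midpoint, which turns convex functions into convex functions of
    [t] that are minimal at [t = 0], hence nondecreasing; the two bounds of the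
    last part are the values at [(0, 0)] and [(1, 1)].
    Integrability is part of the claim: a convex function on [[a, b]] may jump
    at the endpoints, but it has one-sided limits there and agrees inside with
    a continuous function; and the inner integral of a function convex on the
    co-ordinates is convex in the outer variable. *)
Require Import Defs.
From Stdlib Require Import Reals Lra.
From Coquelicot Require Import Coquelicot.
Open Scope R_scope.

(** * Convex functions of one variable: continuity, one-sided limits, integrability *)

Lemma convex_chord (a b : R) (k : R -> R) (x y z : R) :
  convex_on (segment a b) k -> a <= x -> x < z -> z <= b -> x <= y <= z ->
  (z - x) * k y <= (z - y) * k x + (y - x) * k z.
Proof.
intros Hk Hx Hxz Hz Hy.
assert (Hl : 0 <= (z - y) / (z - x) <= 1).
{ split; [apply Rdiv_le_0_compat; lra|].
  apply Rmult_le_reg_r with (z - x); [lra|].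
  unfold Rdiv; rewrite Rmult_assoc, Rinv_l; lra. }
assert (H := Hk x z ((z - y) / (z - x))
  (conj Hx (Rle_trans _ _ _ (Rlt_le _ _ Hxz) Hz))
  (conj (Rle_trans _ _ _ Hx (Rlt_le _ _ Hxz)) Hz) Hl).
replace ((z - y) / (z - x) * x + (1 - (z - y) / (z - x)) * z) with y in H
  by (field; lra).
apply (Rmult_le_compat_l (z - x)) in H; [|lra].
replace ((z - x) * ((z - y) / (z - x) * k x + (1 - (z - y) / (z - x)) * k z))
  with ((z - y) * k x + (y - x) * k z) in H by (field; lra).
exact H.
Qed.

Lemma convex_on_affine (a b p q u v : R) (k : R -> R) :
  convex_on (segment a b) k ->
  (forall x, segment p q x -> segment a b (u * x + v)) ->
  convex_on (segment p q) (fun x => k (u * x + v)).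
Proof.
intros Hk Hin x y l Hx Hy Hl.
replace (u * (l * x + (1 - l) * y) + v)
  with (l * (u * x + v) + (1 - l) * (u * y + v)) by ring.
apply Hk; auto.
Qed.

(** Chords to [x - r] and [x + r] make [k] Lipschitz at [x], with constant [M / r]. *)
Lemma convex_on_continuous (a b : R) (k : R -> R) (x : R) :
  convex_on (segment a b) k -> a < x < b -> continuous k x.
Proof.
intros Hk Hx.
set (r := Rmin (x - a) (b - x)).
assert (Hr : 0 < r) by (apply Rmin_case; lra).
assert (Hra : r <= x - a) by apply Rmin_l.
assert (Hrb : r <= b - x) by apply Rmin_r.
set (M := Rabs (k (x + r) - k x) + Rabs (k (x - r) - k x)).
assert (HM : 0 <= M) by (apply Rplus_le_le_0_compat; apply Rabs_pos).
assert (Hup : forall y, Rabs (y - x) <= r ->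
                r * Rabs (k y - k x) <= M * Rabs (y - x)).
{ intros y Hy.
  assert (Hp := Rle_abs (k (x + r) - k x)).
  assert (Hm := Rle_abs (k (x - r) - k x)).
  assert (Hp0 := Rabs_pos (k (x + r) - k x)).
  assert (Hm0 := Rabs_pos (k (x - r) - k x)).
  apply Rabs_le_between in Hy.
  unfold M; clear M HM.
  revert Hp Hm Hp0 Hm0.
  generalize (Rabs (k (x + r) - k x)) (Rabs (k (x - r) - k x)).
  intros P Q HP HQ HP0 HQ0.
  (* On either side, the chord with [y] in the middle bounds [k y] from above, the one with [x] in
     the middle from below. *)
  destruct (Rle_lt_dec x y) as [Hxy|Hxy].
  - assert (H1 := convex_chord a b k x y (x + r) Hk
      ltac:(lra) ltac:(lra) ltac:(lra) ltac:(lra)).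
    assert (H2 := convex_chord a b k (x - r) x y Hk
      ltac:(lra) ltac:(lra) ltac:(lra) ltac:(lra)).
    rewrite (Rabs_pos_eq (y - x)) by lra.
    unfold Rabs; destruct Rcase_abs; nra.
  - assert (H1 := convex_chord a b k (x - r) y x Hk
      ltac:(lra) ltac:(lra) ltac:(lra) ltac:(lra)).
    assert (H2 := convex_chord a b k y x (x + r) Hk
      ltac:(lra) ltac:(lra) ltac:(lra) ltac:(lra)).
    rewrite (Rabs_left (y - x)) by lra.
    unfold Rabs; destruct Rcase_abs; nra. }
apply filterlim_locally; intros eps.
(* The bound [r] lets [Hup] apply; the other one gives [M * Rabs (y - x) < r * eps]. Dividing by
   [M + 1] covers [M = 0]. *)
assert (Hd : 0 < Rmin r (r * eps / (M + 1))).
{ apply Rmin_case; [lra|]. apply Rdiv_lt_0_compat; [|lra].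
  apply Rmult_lt_0_compat; [lra|apply cond_pos]. }
exists (mkposreal _ Hd); intros y Hy.
change (Rabs (y - x) < Rmin r (r * eps / (M + 1))) in Hy.
change (Rabs (k y - k x) < eps).
assert (H1 := Rlt_le_trans _ _ _ Hy (Rmin_l _ _)).
assert (H2 := Rlt_le_trans _ _ _ Hy (Rmin_r _ _)).
apply (Rmult_lt_compat_r (M + 1)) in H2; [|lra].
replace (r * eps / (M + 1) * (M + 1)) with (r * eps) in H2 by (field; lra).
specialize (Hup y (Rlt_le _ _ H1)).
assert (H0 := Rabs_pos (y - x)).
apply Rmult_lt_reg_l with r; [lra|].
nra.
Qed.

Lemma nondecreasing_lim_at_right (a b m : R) (q : R -> R) : a < b ->
  (forall x, a < x < b -> m <= q x) ->
  (forall x y, a < x -> x <= y -> y < b -> q x <= q y) ->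
  exists l : R, filterlim q (at_right a) (locally l).
Proof.
intros Hab Hm Hq.
(* The limit is the infimum of [q], obtained as minus the supremum of [- q]. *)
destruct (completeness (fun z => exists x, a < x < b /\ z = - q x)) as [l [Hl1 Hl2]].
- exists (- m); intros z [x [Hx ->]]; specialize (Hm x Hx); lra.
- exists (- q ((a + b) / 2)), ((a + b) / 2); split; [lra|reflexivity].
- exists (- l); apply filterlim_locally; intros eps.
  assert (Hex : exists x, a < x < b /\ q x < - l + eps).
  { apply Classical_Prop.NNPP; intros Hn.
    assert (H : l <= l - eps).
    { apply Hl2; intros z [x [Hx ->]].
      destruct (Rlt_le_dec (q x) (- l + eps)); [|lra].
      elim Hn; eauto. }
    assert (H0 := cond_pos eps); lra. }
  destruct Hex as [x [Hx Hqx]].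
  assert (Hd : 0 < x - a) by lra.
  exists (mkposreal _ Hd); intros y Hy Hay.
  change (Rabs (y - a) < x - a) in Hy; apply Rabs_def2 in Hy.
  change (Rabs (q y - - l) < eps).
  assert (H1 : q y <= q x) by (apply Hq; lra).
  assert (H2 : - q y <= l) by (apply Hl1; exists y; split; [lra|reflexivity]).
  apply Rabs_def1; [lra|]. assert (H0 := cond_pos eps); lra.
Qed.

(* The chord slopes [(k b - k x) / (b - x)] increase with [x] and are bounded
   below by the slope at [x = a]. *)
Lemma convex_on_lim_at_right (a b : R) (k : R -> R) : a < b ->
  convex_on (segment a b) k ->
  exists l : R, filterlim k (at_right a) (locally l).
Proof.
intros Hab Hk.
assert (Hq : forall x y, a <= x -> x <= y -> y < b ->
               (k b - k x) / (b - x) <= (k b - k y) / (b - y)).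
{ intros x y Hx Hxy Hy.
  assert (H := convex_chord a b k x y b Hk
    ltac:(lra) ltac:(lra) ltac:(lra) ltac:(lra)).
  apply Rmult_le_reg_r with ((b - x) * (b - y)); [nra|].
  replace ((k b - k x) / (b - x) * ((b - x) * (b - y)))
    with ((k b - k x) * (b - y)) by (field; lra).
  replace ((k b - k y) / (b - y) * ((b - x) * (b - y)))
    with ((k b - k y) * (b - x)) by (field; lra).
  nra. }
destruct (nondecreasing_lim_at_right a b ((k b - k a) / (b - a))
  (fun x => (k b - k x) / (b - x)) Hab) as [l Hl].
- intros x Hx; apply Hq; lra.
- intros x y Hx Hxy Hy; apply Hq; lra.
(* Solving the slope for [k x] gives [k b] minus slope times [b - x], whose factors all have
   limits. *)
- exists (k b + - (l * (b + - a))).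
  apply filterlim_ext_loc with (fun x => k b + - ((k b - k x) / (b - x) * (b + - x))).
  { assert (Hd : 0 < b - a) by lra.
    exists (mkposreal _ Hd); intros y Hy Hay.
    change (Rabs (y - a) < b - a) in Hy; apply Rabs_def2 in Hy.
    field; lra. }
  assert (Hid : filterlim (fun x : R => x) (at_right a) (locally a)).
  { apply filterlim_filter_le_1 with (2 := filterlim_id _ (locally a)).
    apply filter_le_within. }
  assert (Hopp : forall (u : R -> R) (z : R), filterlim u (at_right a) (locally z) ->
            filterlim (fun x => - u x) (at_right a) (locally (- z))).
  { intros u z Hu; eapply filterlim_comp; [exact Hu|apply (filterlim_opp z)]. }
  eapply (filterlim_comp_2 (G := locally _) (H := locally _));
    [apply filterlim_const | | apply (filterlim_plus (k b) (- (l * (b + - a))))].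
  apply Hopp.
  eapply (filterlim_comp_2 (G := locally _) (H := locally _));
    [exact Hl | | apply (filterlim_mult l (b + - a))].
  eapply (filterlim_comp_2 (G := locally _) (H := locally _));
    [apply filterlim_const | | apply (filterlim_plus b (- a))].
  now apply Hopp.
Qed.

(** The reflection of the segment about its midpoint keeps convexity and exchanges the two ends. *)
Lemma convex_on_lim_at_left (a b : R) (k : R -> R) : a < b ->
  convex_on (segment a b) k ->
  exists l : R, filterlim k (at_left b) (locally l).
Proof.
intros Hab Hk.
destruct (convex_on_lim_at_right a b (fun x => k (-1 * x + (a + b))) Hab) as [l Hl].
- apply convex_on_affine with (1 := Hk); unfold segment; intros; lra.
- exists l.
  apply filterlim_ext with (fun x => k (-1 * (-1 * x + (a + b)) + (a + b))).
  { intros x; f_equal; ring. }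
  apply filterlim_comp with (2 := Hl) (f := fun x => -1 * x + (a + b)).
  intros P [d Hd]; exists d; intros y Hy Hyb.
  apply Hd; [|lra].
  change (Rabs (y - b) < d) in Hy.
  change (Rabs (-1 * y + (a + b) - a) < d).
  now replace (-1 * y + (a + b) - a) with (- (y - b)) by ring; rewrite Rabs_Ropp.
Qed.

Lemma convex_on_ex_RInt (a b : R) (k : R -> R) : a < b ->
  convex_on (segment a b) k -> ex_RInt k a b.
Proof.
intros Hab Hk.
destruct (convex_on_lim_at_right a b k Hab Hk) as [la Hla].
destruct (convex_on_lim_at_left a b k Hab Hk) as [lb Hlb].
(* [h] is continuous everywhere and equals [k] strictly inside; [ex_RInt_ext] ignores the endpoints,
   where [k] may jump. *)
destruct (C0_extension_lt k la lb a b Hab) as [h [Hh [Hext _]]]; auto.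
{ intros x Hx; now apply convex_on_continuous with a b. }
apply ex_RInt_ext with h.
- rewrite Rmin_left, Rmax_right by lra; auto.
- apply (ex_RInt_continuous (V := R_CompleteNormedModule)); intros x _; apply Hh.
Qed.

(** The convexity inequality is integrated pointwise in [x]. It serves both for dilation parameters
    and for the outer variable of the double integral. *)
Lemma RInt_convex_on (a b p q : R) (F : R -> R -> R) : a <= b ->
  (forall x, segment a b x -> convex_on (segment p q) (F x)) ->
  (forall s, segment p q s -> ex_RInt (fun x => F x s) a b) ->
  convex_on (segment p q) (fun s => RInt (fun x => F x s) a b).
Proof.
intros Hab HF Hex u w l Hu Hw Hl.
assert (Hs : segment p q (l * u + (1 - l) * w)) by (unfold segment in *; nra).
assert (Hi1 := RInt_correct _ _ _ (Hex u Hu)).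
assert (Hi2 := RInt_correct _ _ _ (Hex w Hw)).
assert (Hi3 := RInt_correct _ _ _ (Hex _ Hs)).
assert (Hi := is_RInt_plus _ _ _ _ _ _ (is_RInt_scal _ _ _ l _ Hi1)
                (is_RInt_scal _ _ _ (1 - l) _ Hi2)).
refine (is_RInt_le _ _ _ _ _ _ Hab Hi3 Hi _).
intros x Hx; apply HF; auto; unfold segment; lra.
Qed.

(** * The one-variable dilation operator *)

Definition dilation_int (a b : R) (k : R -> R) (t : R) : R :=
  RInt (fun x => k (t * x + (1 - t) * ((a + b) / 2))) a b.

Lemma dilation_segment (a b t x : R) :
  segment a b x -> 0 <= t <= 1 -> segment a b (t * x + (1 - t) * ((a + b) / 2)).
Proof. unfold segment; nra. Qed.

Lemma convex_on_dilation (a b t : R) (k : R -> R) :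
  convex_on (segment a b) k -> 0 <= t <= 1 ->
  convex_on (segment a b) (fun x => k (t * x + (1 - t) * ((a + b) / 2))).
Proof.
intros Hk Ht; apply convex_on_affine with (1 := Hk).
intros x Hx; now apply dilation_segment.
Qed.

Lemma ex_RInt_dilation (a b t : R) (k : R -> R) : a < b ->
  convex_on (segment a b) k -> 0 <= t <= 1 ->
  ex_RInt (fun x => k (t * x + (1 - t) * ((a + b) / 2))) a b.
Proof.
intros Hab Hk Ht; apply convex_on_ex_RInt; auto; now apply convex_on_dilation.
Qed.

(** For fixed [x] the argument of [k] is affine in [t], so every integrand is convex in [t]. *)
Lemma dilation_int_convex (a b : R) (k : R -> R) : a < b ->
  convex_on (segment a b) k -> convex_on (segment 0 1) (dilation_int a b k).
Proof.
intros Hab Hk.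
apply (RInt_convex_on a b 0 1 (fun x t => k (t * x + (1 - t) * ((a + b) / 2)))).
- lra.
- intros x Hx u w l Hu Hw Hl.
  replace ((l * u + (1 - l) * w) * x + (1 - (l * u + (1 - l) * w)) * ((a + b) / 2))
    with (l * (u * x + (1 - u) * ((a + b) / 2))
          + (1 - l) * (w * x + (1 - w) * ((a + b) / 2))) by ring.
  apply Hk; auto; now apply dilation_segment.
- intros t Ht; now apply ex_RInt_dilation.
Qed.

Lemma dilation_int_0 (a b : R) (k : R -> R) :
  dilation_int a b k 0 = (b - a) * k ((a + b) / 2).
Proof.
unfold dilation_int.
rewrite RInt_ext with (g := fun _ => k ((a + b) / 2)).
- rewrite RInt_const; reflexivity.
- intros x _; f_equal; ring.
Qed.

Lemma dilation_int_1 (a b : R) (k : R -> R) :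
  dilation_int a b k 1 = RInt k a b.
Proof. apply RInt_ext; intros x _; f_equal; ring. Qed.

(* Hermite-Hadamard: average the integrand with its reflection about the
   midpoint. *)
Lemma dilation_int_ge_0 (a b t : R) (k : R -> R) : a < b ->
  convex_on (segment a b) k -> 0 <= t <= 1 ->
  dilation_int a b k 0 <= dilation_int a b k t.
Proof.
intros Hab Hk Ht; rewrite dilation_int_0.
set (K := fun x => k (t * x + (1 - t) * ((a + b) / 2))).
change (dilation_int a b k t) with (RInt K a b).
assert (HK : ex_RInt K a b) by now apply ex_RInt_dilation.
assert (Hi := RInt_correct _ _ _ HK).
assert (Hr : is_RInt (fun x => K (-1 * x + (a + b))) a b (RInt K a b)).
(* The reflection swaps the bounds, which flips the sign; the factor [-1] of the substitution
   restores it. *)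
{ assert (Hs : is_RInt K (-1 * a + (a + b)) (-1 * b + (a + b)) (- RInt K a b)).
  { replace (-1 * a + (a + b)) with b by ring.
    replace (-1 * b + (a + b)) with a by ring.
    now apply (is_RInt_swap K). }
  apply (is_RInt_comp_lin K (-1) (a + b)) in Hs.
  apply (is_RInt_scal _ _ _ (-1)) in Hs.
  replace (RInt K a b) with (scal (-1) (- RInt K a b))
    by (change (-1 * - RInt K a b = RInt K a b); ring).
  apply is_RInt_ext with (2 := Hs).
  intros x _; change (-1 * (-1 * K (-1 * x + (a + b))) = K (-1 * x + (a + b))); ring. }
assert (Hsum := is_RInt_plus _ _ _ _ _ _ Hi Hr).
assert (Hc := is_RInt_const a b (2 * k ((a + b) / 2))).
assert (H : scal (b - a) (2 * k ((a + b) / 2)) <= plus (RInt K a b) (RInt K a b)).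
{ refine (is_RInt_le _ _ _ _ _ _ (Rlt_le _ _ Hab) Hc Hsum _).
  intros x Hx.
  change (2 * k ((a + b) / 2) <= K x + K (-1 * x + (a + b))).
  assert (H := Hk (t * x + (1 - t) * ((a + b) / 2))
    (t * (-1 * x + (a + b)) + (1 - t) * ((a + b) / 2)) (1 / 2)
    ltac:(apply dilation_segment; unfold segment; lra)
    ltac:(apply dilation_segment; unfold segment; lra) ltac:(lra)).
  replace (1 / 2 * (t * x + (1 - t) * ((a + b) / 2)) +
    (1 - 1 / 2) * (t * (-1 * x + (a + b)) + (1 - t) * ((a + b) / 2)))
    with ((a + b) / 2) in H by field.
  unfold K; lra. }
change ((b - a) * (2 * k ((a + b) / 2)) <= RInt K a b + RInt K a b) in H.
lra.
Qed.

Lemma dilation_int_mono (a b t1 t2 : R) (k : R -> R) : a < b ->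
  convex_on (segment a b) k -> 0 <= t1 -> t1 <= t2 -> t2 <= 1 ->
  dilation_int a b k t1 <= dilation_int a b k t2.
Proof.
intros Hab Hk H1 H12 H2.
(* Now [t2 > 0], so the chord from [0] to [t2] bounds the value at [t1] by a weighted mean of the
   end values, the larger being at [t2]. *)
destruct (Req_dec t1 t2) as [->|Hne]; [lra|].
assert (H0 := dilation_int_ge_0 a b t2 k Hab Hk ltac:(lra)).
assert (H := convex_chord 0 1 _ 0 t1 t2 (dilation_int_convex a b k Hab Hk)
  ltac:(lra) ltac:(lra) ltac:(lra) ltac:(lra)).
nra.
Qed.

(** * The double integral as an iterated dilation *)

Lemma inner_dilation_convex (a b c d : R) (phi : R -> R -> R) (s : R) : c < d ->
  coord_convex a b c d phi -> 0 <= s <= 1 ->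
  convex_on (segment a b) (fun u => dilation_int c d (phi u) s).
Proof.
intros hcd [Hx Hy] Hs.
apply (RInt_convex_on c d a b
  (fun y u => phi u (s * y + (1 - s) * ((c + d) / 2)))).
- lra.
- intros y Hyc; apply Hy; now apply dilation_segment.
- intros u Hu; now apply ex_RInt_dilation; [|apply Hx|].
Qed.

Lemma Hmap_dilation (a b c d : R) (phi : R -> R -> R) (t s : R) :
  Hmap a b c d phi t s = 1 / ((b - a) * (d - c)) *
    dilation_int a b (fun u => dilation_int c d (phi u) s) t.
Proof. reflexivity. Qed.

Lemma mean_weight_pos (a b c d : R) : a < b -> c < d ->
  0 < 1 / ((b - a) * (d - c)).
Proof. intros hab hcd; apply Rdiv_lt_0_compat; [lra|]. apply Rmult_lt_0_compat; lra. Qed.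

Lemma convex_on_scal (I : R -> Prop) (r : R) (k : R -> R) :
  0 <= r -> convex_on I k -> convex_on I (fun x => r * k x).
Proof.
intros Hr Hk u w l Hu Hw Hl.
replace (l * (r * k u) + (1 - l) * (r * k w))
  with (r * (l * k u + (1 - l) * k w)) by ring.
apply Rmult_le_compat_l; auto.
Qed.

(** The order of integration stays fixed: in [s] the inner integrals are convex and the outer one
    preserves this; in [t] the outer dilation acts on a convex inner integral. *)
Lemma Hmap_coord_convex (a b c d : R) (phi : R -> R -> R) : a < b -> c < d ->
  coord_convex a b c d phi -> coord_convex 0 1 0 1 (Hmap a b c d phi).
Proof.
intros hab hcd Hphi; assert (Hw := mean_weight_pos a b c d hab hcd).
split; [intros t Ht|intros s Hs]; apply convex_on_scal; try lra.
- apply (RInt_convex_on a b 0 1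
    (fun x => dilation_int c d (phi (t * x + (1 - t) * ((a + b) / 2))))).
  + lra.
  + intros x Hx; apply dilation_int_convex; [assumption|].
    apply (proj1 Hphi); now apply dilation_segment.
  + intros s Hs.
    apply (ex_RInt_dilation a b t (fun u => dilation_int c d (phi u) s)); auto.
    now apply inner_dilation_convex.
- apply (dilation_int_convex a b (fun u => dilation_int c d (phi u) s)); [exact hab|].
  now apply inner_dilation_convex.
Qed.

Lemma Hmap_mono (a b c d : R) (phi : R -> R -> R) (t1 t2 s1 s2 : R) : a < b -> c < d ->
  coord_convex a b c d phi ->
  0 <= t1 -> t1 <= t2 -> t2 <= 1 -> 0 <= s1 -> s1 <= s2 -> s2 <= 1 ->
  Hmap a b c d phi t1 s1 <= Hmap a b c d phi t2 s2.
Proof.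
intros hab hcd Hphi Ht1 Ht Ht2 Hs1 Hs Hs2; assert (Hw := mean_weight_pos a b c d hab hcd).
rewrite !Hmap_dilation; apply Rmult_le_compat_l; [lra|].
(* Passing through [(t2, s1)] changes one parameter at a time; the change in [s] is compared under
   the outer integral. *)
apply Rle_trans with (dilation_int a b (fun u => dilation_int c d (phi u) s1) t2).
- apply dilation_int_mono; auto; apply inner_dilation_convex; auto; lra.
- apply RInt_le; [lra| | |].
  + apply (ex_RInt_dilation a b t2 (fun u => dilation_int c d (phi u) s1)); auto;
      [apply inner_dilation_convex; auto|]; lra.
  + apply (ex_RInt_dilation a b t2 (fun u => dilation_int c d (phi u) s2)); auto;
      [apply inner_dilation_convex; auto|]; lra.
  + intros x Hx; apply dilation_int_mono; auto.
    apply (proj1 Hphi); apply dilation_segment; unfold segment; lra.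
Qed.

(** Convexity of [p] and [q] supplies the integrability that linearity of [RInt] requires, at both
    levels. *)
Lemma Hmap_linear (a b c d : R) (phi p q : R -> R -> R) (alpha beta t s : R) : a < b -> c < d ->
  coord_convex a b c d p -> coord_convex a b c d q ->
  (forall x y, phi x y = alpha * p x y + beta * q x y) ->
  0 <= t <= 1 -> 0 <= s <= 1 ->
  Hmap a b c d phi t s = alpha * Hmap a b c d p t s + beta * Hmap a b c d q t s.
Proof.
intros hab hcd Hp Hq Hphi Ht Hs.
assert (Hlin : forall (u v w : R -> R) (e e' : R), ex_RInt u e e' -> ex_RInt v e e' ->
  (forall x, Rmin e e' < x < Rmax e e' -> w x = alpha * u x + beta * v x) ->
  RInt w e e' = alpha * RInt u e e' + beta * RInt v e e').
{ intros u v w e e' Hu Hv Hw.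
  rewrite (RInt_ext _ _ _ _ Hw).
  apply is_RInt_unique.
  exact (is_RInt_plus _ _ _ _ _ _
    (is_RInt_scal _ _ _ alpha _ (RInt_correct _ _ _ Hu))
    (is_RInt_scal _ _ _ beta _ (RInt_correct _ _ _ Hv))). }
assert (E : dilation_int a b (fun u => dilation_int c d (phi u) s) t =
  alpha * dilation_int a b (fun u => dilation_int c d (p u) s) t +
  beta * dilation_int a b (fun u => dilation_int c d (q u) s) t);
  [|rewrite !Hmap_dilation, E; ring].
apply (Hlin (fun x => dilation_int c d (p (t * x + (1 - t) * ((a + b) / 2))) s)
            (fun x => dilation_int c d (q (t * x + (1 - t) * ((a + b) / 2))) s)
            (fun x => dilation_int c d (phi (t * x + (1 - t) * ((a + b) / 2))) s)).
- apply (ex_RInt_dilation a b t (fun u => dilation_int c d (p u) s)); auto.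
  now apply inner_dilation_convex.
- apply (ex_RInt_dilation a b t (fun u => dilation_int c d (q u) s)); auto.
  now apply inner_dilation_convex.
- intros x Hx; rewrite (Rmin_left a b), (Rmax_right a b) in Hx by lra.
  assert (Hin := dilation_segment a b t x
    (conj (Rlt_le _ _ (proj1 Hx)) (Rlt_le _ _ (proj2 Hx))) Ht).
  apply Hlin.
  + apply ex_RInt_dilation; auto; now apply (proj1 Hp).
  + apply ex_RInt_dilation; auto; now apply (proj1 Hq).
  + intros y _; apply Hphi.
Qed.

Lemma Hmap_1_1 (a b c d : R) (phi : R -> R -> R) : Hmap a b c d phi 1 1 = mean_value a b c d phi.
Proof.
rewrite Hmap_dilation, dilation_int_1; unfold mean_value; f_equal.
apply RInt_ext; intros x _; apply dilation_int_1.
Qed.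

Lemma Hmap_0_0 (a b c d : R) (phi : R -> R -> R) : a < b -> c < d ->
  Hmap a b c d phi 0 0 = phi ((a + b) / 2) ((c + d) / 2).
Proof. intros hab hcd; rewrite Hmap_dilation, !dilation_int_0; field; lra. Qed.

(** * Domination as a pair of convexities, and the conclusion *)

Lemma convex_dominated_on_split (I : R -> Prop) (k h : R -> R) :
  convex_dominated_on I k h <->
  convex_on I (fun x => k x + h x) /\ convex_on I (fun x => k x - h x).
Proof.
split.
- intros H; split; intros u w l Hu Hw Hl;
    specialize (H u w l Hu Hw Hl);
    apply Rabs_le_between in H; lra.
- intros [H1 H2] u w l Hu Hw Hl.
  specialize (H1 u w l Hu Hw Hl); specialize (H2 u w l Hu Hw Hl).
  apply Rabs_le; lra.
Qed.

(** Equality on the segment must suffice, because [Hmap_linear] covers only parameters in [0,1]. *)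
Lemma convex_on_ext (p q : R) (h k : R -> R) :
  (forall x, segment p q x -> h x = k x) ->
  convex_on (segment p q) h -> convex_on (segment p q) k.
Proof.
intros Heq Hh u w l Hu Hw Hl.
rewrite <- !Heq; auto; unfold segment in *; nra.
Qed.

Theorem theorem6 (a b c d : R) (f g : R -> R -> R)
    (hab : a < b) (hcd : c < d)
    (hg : coord_convex a b c d g)
    (hf : coord_convex_dominated a b c d g f) :
  (coord_convex 0 1 0 1 (Hmap a b c d g) /\
   coord_convex_dominated 0 1 0 1 (Hmap a b c d g) (Hmap a b c d f)) /\
  (forall t1 t2 s1 s2 : R,
     0 <= t1 -> t1 < t2 -> t2 <= 1 -> 0 <= s1 -> s1 < s2 -> s2 <= 1 ->
     0 <= Rabs (Hmap a b c d f t2 s2 - Hmap a b c d f t1 s1)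
       <= Hmap a b c d g t2 s2 - Hmap a b c d g t1 s1) /\
  (forall t s : R, 0 <= t <= 1 -> 0 <= s <= 1 ->
     Rabs (f ((a + b) / 2) ((c + d) / 2) - Hmap a b c d f t s)
       <= Hmap a b c d g t s - g ((a + b) / 2) ((c + d) / 2) /\
     Rabs (mean_value a b c d f - Hmap a b c d f t s)
       <= mean_value a b c d g - Hmap a b c d g t s).
Proof.
set (p := fun x y => g x y + f x y).
set (q := fun x y => g x y - f x y).
assert (Hp : coord_convex a b c d p).
{ split; [intros x Hx; apply (proj1 hf) in Hx|intros y Hy; apply (proj2 hf) in Hy];
    now apply convex_dominated_on_split. }
assert (Hq : coord_convex a b c d q).
{ split; [intros x Hx; apply (proj1 hf) in Hx|intros y Hy; apply (proj2 hf) in Hy];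
    now apply convex_dominated_on_split. }
assert (Eg : forall t s, 0 <= t <= 1 -> 0 <= s <= 1 -> Hmap a b c d g t s =
               / 2 * Hmap a b c d p t s + / 2 * Hmap a b c d q t s).
{ intros t s; apply Hmap_linear; auto; intros x y; unfold p, q; field. }
assert (Ef : forall t s, 0 <= t <= 1 -> 0 <= s <= 1 -> Hmap a b c d f t s =
               / 2 * Hmap a b c d p t s + - / 2 * Hmap a b c d q t s).
{ intros t s; apply Hmap_linear; auto; intros x y; unfold p, q; field. }
(* Weak inequalities let this serve (ii) and also (iii), where one point is [(0, 0)] or [(1, 1)].
   With increments P, Q >= 0 of [Hmap] for [p] and [q], it reads |P - Q| / 2 <= (P + Q) / 2. *)
assert (Hmono : forall t1 t2 s1 s2,
  0 <= t1 -> t1 <= t2 -> t2 <= 1 -> 0 <= s1 -> s1 <= s2 -> s2 <= 1 ->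
  Rabs (Hmap a b c d f t2 s2 - Hmap a b c d f t1 s1)
    <= Hmap a b c d g t2 s2 - Hmap a b c d g t1 s1).
{ intros t1 t2 s1 s2 Ht1 Ht Ht2 Hs1 Hs Hs2.
  rewrite !Eg, !Ef by lra.
  assert (H1 := Hmap_mono a b c d p t1 t2 s1 s2 hab hcd Hp Ht1 Ht Ht2 Hs1 Hs Hs2).
  assert (H2 := Hmap_mono a b c d q t1 t2 s1 s2 hab hcd Hq Ht1 Ht Ht2 Hs1 Hs Hs2).
  apply Rabs_le; lra. }
split; [split|split].
- now apply Hmap_coord_convex.
- destruct (Hmap_coord_convex a b c d p hab hcd Hp) as [Hp1 Hp2].
  destruct (Hmap_coord_convex a b c d q hab hcd Hq) as [Hq1 Hq2].
  split; [intros t Ht|intros s Hs]; apply convex_dominated_on_split; split.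
  (* On the unit square, H_g + H_f = H_p and H_g - H_f = H_q. *)
  + apply convex_on_ext with (2 := Hp1 t Ht); intros s Hs; rewrite Eg, Ef by auto; field.
  + apply convex_on_ext with (2 := Hq1 t Ht); intros s Hs; rewrite Eg, Ef by auto; field.
  + apply convex_on_ext with (2 := Hp2 s Hs); intros t Ht; rewrite Eg, Ef by auto; field.
  + apply convex_on_ext with (2 := Hq2 s Hs); intros t Ht; rewrite Eg, Ef by auto; field.
- intros t1 t2 s1 s2 Ht1 Ht Ht2 Hs1 Hs Hs2; split; [apply Rabs_pos|].
  apply Hmono; lra.
- intros t s Ht Hs; split.
  + rewrite <- (Hmap_0_0 a b c d f hab hcd), <- (Hmap_0_0 a b c d g hab hcd).
    rewrite Rabs_minus_sym; apply Hmono; lra.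
  + rewrite <- !Hmap_1_1; apply Hmono; lra.
Qed.
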